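(* Let $k\in\mathbb{N}$ with $k\ge 3$, and let $\alpha=\frac{2k}{3}-1$. For any $\epsilon>0$ there exists a constant $c>0$ such that, for all $m\ge k$, every simple $m\times\lfloor cm^{k-1}\rfloor$ matrix makes at least $m^{k-1-\alpha-\epsilon}$ contributions.
   Context: All matrices have entries in $\{0,1\}$. A matrix is simple if its columns are pairwise distinct. For an $m\times n$ matrix $M$, $R\subseteq[m]=\{1,\dots,m\}$ and $C\subseteq[n]$, $M[R,C]$ denotes the $|R|\times|C|$ submatrix of $M$ with rows indexed by $R$ and columns indexed by $C$; $[a]^{(b)}$ denotes the set of $b$-element subsets of $[a]$. Fix $k$. For an $m\times n$ simple matrix $M$, a collection $(R_1,C_1),\dots,(R_i,C_i)\in[m]^{(k)}\times[n]^{(2^k)}$ is a set of $i$ contributions if $M[R_j,C_j]$ is a simple matrix for all $j\le i$ and, for any $j\ne j'$ with $R_j=R_{j'}$, either $\max C_j<\min C_{j'}$ or $\max C_{j'}<\min C_j$. For a real number $t\ge 0$, $M$ makes (at least) $t$ contributions if there exists a set of at least $t$ contributions for $M$. *)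

(* Defs.v *)
From HB Require Import structures.
From mathcomp Require Import all_boot all_order all_algebra.
From mathcomp Require Import all_classical all_reals all_analysis.

Set Implicit Arguments.
Unset Strict Implicit.
Unset Printing Implicit Defensive.

Import Order.TTheory GRing.Theory Num.Theory.

Definition simple_mx m n (M : 'M[bool]_(m, n)) : Prop :=
  injective (fun j : 'I_n => col j M).

(* enum_val lists a set of ordinals increasingly, so rows and columns keep
   their order. *)
Definition submatrix m n (M : 'M[bool]_(m, n)) (R : {set 'I_m}) (C : {set 'I_n}) :
    'M[bool]_(#|R|, #|C|) :=
  mxsub (fun i : 'I_#|R| => enum_val i) (fun j : 'I_#|C| => enum_val j) M.

(* Only applied to nonempty sets; on the empty set these are 0 and n. *)
Definition max_idx n (C : {set 'I_n}) : nat := \max_(x in C) (x : nat).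
Definition min_idx n (C : {set 'I_n}) : nat := \big[minn/n]_(x in C) (x : nat).

(* A set of pairs loses nothing over an indexed family: the separation
   condition forces distinct indices to carry distinct pairs. *)
Definition contributions k m n (M : 'M[bool]_(m, n))
    (S : {set {set 'I_m} * {set 'I_n}}) : Prop :=
  (forall p, p \in S ->
     [/\ #|p.1| = k, #|p.2| = (2 ^ k)%N & simple_mx (submatrix M p.1 p.2)]) /\
  (forall p q, p \in S -> q \in S -> p <> q -> p.1 = q.1 ->
     (max_idx p.2 < min_idx q.2)%N \/ (max_idx q.2 < min_idx p.2)%N).

Definition makes_contributions (R : realType) k m n (M : 'M[bool]_(m, n))
    (t : R) : Prop :=
  exists S, contributions k M S /\ (t <= #|S|%:R)%R.

(* Main.v *)
(* Let X be the maximal number of contributions. If every matrix with m rows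
   and C m^(k-1) columns makes m^b contributions, then cutting a matrix with
   more columns into consecutive blocks shows that any s of the m rows carry
   only O(X s^g) distinct traces, where g = k-1-b. Order-shattering produces
   at least m^(k-1) shattered sets of size at least k whose number inside any s
   rows is bounded by the number of traces there. A family obeying this bound
   branches a lot: writing d(A) for the number of members containing A, above A
   there are about (d(A)/X)^(1/g) ways to add a point, none of which keeps more
   than a small fraction of d(A). Hence the family has many k-subsets, each
   giving a contribution: X >= (m^(k-1)/X)^(1-(1-1/g)^k) up to m^o(1). As
   1-(1-1/g)^k >= (g+1)/(2g), this improves b whenever b < k/3, halving the gap
   k/3 - b, and iterating from b = 0 reaches every exponent k/3 - eps. *)

Require Import Defs.
From HB Require Import structures.
From mathcomp Require Import all_boot all_order all_algebra.
From mathcomp Require Import all_classical all_reals all_analysis.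
From mathcomp Require Import zify ring lra.

Set Implicit Arguments.
Unset Strict Implicit.
Unset Printing Implicit Defensive.

Import Order.TTheory GRing.Theory Num.Theory.
Local Open Scope ring_scope.

Lemma subseq_catP (T : eqType) (s1 s2 s : seq T) :
  subseq (s1 ++ s2) s ->
  exists t1 t2, [/\ s = t1 ++ t2, subseq s1 t1 & subseq s2 t2].
Proof.
elim: s s1 => [|x s ih] [|y s1] //=.
- by move=> h; exists [::], [::].
- by move=> h; exists [::], (x :: s).
case: eqP => [<-|ne] h.
  have [t1 [t2 [-> h1 h2]]] := ih _ h.
  by exists (y :: t1), t2; rewrite /= eqxx.
have [t1 [t2 [-> h1 h2]]] := ih (y :: s1) h.
exists (x :: t1), t2; split => //=.
by case: eqP => // e; case: ne.
Qed.

(** * Counting separated shattering segments *)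

Section Segments.
Context {T : finType}.
Implicit Types (s : seq {set T}) (A B R S : {set T}).
Local Open Scope nat_scope.

Definition shatters s R : bool :=
  [forall A : {set T}, (A \subset R) ==> has (fun B => B :&: R == A) s].

Lemma shattersP s R :
  reflect (forall A, A \subset R -> exists2 B, B \in s & B :&: R = A)
          (shatters s R).
Proof.
apply: (iffP forallP) => [h A AR|h A].
  have /hasP[B Bs /eqP BR] := implyP (h A) AR; by exists B.
apply/implyP => /h[B Bs BR]; apply/hasP; exists B => //; exact/eqP.
Qed.

Lemma shatters_subset s s' R : {subset s <= s'} -> shatters s R -> shatters s' R.
Proof.
move=> ss' /shattersP h; apply/shattersP => A /h[B Bs BR]; exists B => //.
exact: ss'.
Qed.

Lemma shatters_subr s R R' : R' \subset R -> shatters s R -> shatters s R'.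
Proof.
move=> R'R /shattersP h; apply/shattersP => A AR'.
have [B Bs BR] := h A (fintype.subset_trans AR' R'R); exists B => //.
have -> : R' = R :&: R' by apply/esym/finset.setIidPr.
by rewrite finset.setIA BR; apply/finset.setIidPl.
Qed.

Lemma shatters_trace s S R : R \subset S ->
  shatters [seq A :&: S | A <- s] R = shatters s R.
Proof.
move=> RS; apply: eq_forallb => A; congr (_ ==> _).
rewrite has_map; apply: eq_has => B /=.
by rewrite -finset.setIA (finset.setIidPr RS).
Qed.

(** Each of the [p] consecutive blocks contains a column for every subset of [R], hence one
    contribution on the rows [R]; that the blocks follow one another supplies the separation of
    column indices. The rest of [s] is arbitrary. *)
Fixpoint segments R p s : Prop :=
  if p is p'.+1 then
    exists s1 s2, [/\ s = s1 ++ s2, shatters s1 R & segments R p' s2]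
  else True.

Lemma segments_size R p s : segments R p s -> p <= size s.
Proof.
elim: p s => [//|p ih] s /= [s1 [s2 [-> /shattersP h /ih h2]]].
have [B Bs1 _] := h finset.set0 (finset.sub0set R).
rewrite size_cat; case: s1 Bs1 {h} => //= x s1 _; lia.
Qed.

Lemma segments_subseq R p s s' : subseq s s' -> segments R p s -> segments R p s'.
Proof.
elim: p s s' => [//|p ih] s s' ss' /= [s1 [s2 [es h1 h2]]].
move: ss'; rewrite es => /subseq_catP[t1 [t2 [-> h3 h4]]].
exists t1, t2; split => //; last exact: ih h2.
by apply: shatters_subset h1; exact: mem_subseq.
Qed.

Lemma segments_cat R p q s t :
  segments R p s -> segments R q t -> segments R (p + q) (s ++ t).
Proof.
elim: p s => [|p ih] s /=.
  by move=> _; apply: segments_subseq; exact: suffix_subseq.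
move=> [s1 [s2 [-> h1 h2]]] h; exists s1, (s2 ++ t).
by rewrite catA; split => //; exact: ih.
Qed.

Lemma segments_trace R S p s : R \subset S ->
  segments R p [seq A :&: S | A <- s] -> segments R p s.
Proof.
move=> RS; elim: p s => [//|p ih] s /= [s1 [s2 [e h1 h2]]].
have e1 : s1 = [seq A :&: S | A <- take (size s1) s].
  by rewrite map_take e take_size_cat.
have e2 : s2 = [seq A :&: S | A <- drop (size s1) s].
  by rewrite map_drop e drop_size_cat.
exists (take (size s1) s), (drop (size s1) s); split.
- by rewrite cat_take_drop.
- by rewrite -(shatters_trace _ RS) -e1.
- by apply: ih; rewrite -e2.
Qed.

(** A shattering block is never empty, so no [p] above [size s] is possible and the bounded maximum
    misses nothing. *)
Definition segment_count R s : nat :=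
  \max_(p < (size s).+1 | `[< segments R p s >]) p.

Lemma segment_countP R s : segments R (segment_count R s) s.
Proof.
rewrite /segment_count; apply: (big_ind (fun p => segments R p s)) => //.
- move=> p q hp hq; rewrite /maxn; by case: ifP.
- by move=> p /asboolP.
Qed.

Lemma leq_segment_count R p s : segments R p s -> p <= segment_count R s.
Proof.
move=> h; have ps := segments_size h.
rewrite /segment_count.
apply: (@leq_bigmax_cond _ (fun p : 'I_(size s).+1 => `[< segments R p s >])
          (fun p => p : nat) (Ordinal (ps : p < (size s).+1))).
exact/asboolP.
Qed.

Variable k : nat.

(* The number of contributions of the column sequence [s] on the rows [S]. *)
Definition total_count S s : nat :=
  \sum_(R : {set T} | (R \subset S) && (#|R| == k)) segment_count R s.

(** Superadditivity: for each row set, the blocks found in [s] are followed by those found in [t].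
    This turns long column sequences into many contributions. *)
Lemma total_count_cat S s t :
  total_count S s + total_count S t <= total_count S (s ++ t).
Proof.
rewrite /total_count -big_split; apply: leq_sum => R _.
by apply: leq_segment_count; apply: segments_cat; exact: segment_countP.
Qed.

Lemma total_count_subseq S s t : subseq s t -> total_count S s <= total_count S t.
Proof.
move=> st; apply: leq_sum => R _; apply: leq_segment_count.
apply: segments_subseq st _; exact: segment_countP.
Qed.

(** Blocks of the trace sequence lift to blocks of [s]. Removing repetitions gives a sequence to
    which a guarantee on the rows [S'] applies, so the number of distinct traces can be limited by
    the count for [s]. *)
Lemma total_count_trace S S' s : S' \subset S ->
  total_count S' (undup [seq A :&: S' | A <- s]) <= total_count S s.
Proof.
move=> S'S; apply: leq_trans (total_count_subseq S' (undup_subseq _)) _.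
rewrite /total_count; apply: (@leq_trans
  (\sum_(R : {set T} | (R \subset S') && (#|R| == k)) segment_count R s)).
  apply: leq_sum => R /andP[RS' _]; apply: leq_segment_count.
  apply: segments_trace RS' _; exact: segment_countP.
rewrite [X in _ <= X](bigID (fun R : {set T} => R \subset S')) /=.
apply: leq_trans (leq_addr _ _); apply: eq_leq; apply: eq_bigl => R.
case RS' : (R \subset S') => //=; last by rewrite andbF.
by rewrite andbT (fintype.subset_trans RS' S'S).
Qed.

Lemma shattered_leq_total_count S s :
  #|[set R : {set T} | [&& R \subset S, #|R| == k & shatters s R]]|
    <= total_count S s.
Proof.
rewrite -sum1_card /total_count.
rewrite [X in _ <= X](bigID (fun R => shatters s R)) /=.
apply: leq_trans (leq_addr _ _).
rewrite (eq_bigl (fun R : {set T} => (R \subset S) && (#|R| == k) && shatters s R)); last first.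
  by move=> R; rewrite inE andbA.
apply: leq_sum => R /andP[_ h]; apply: leq_segment_count => /=.
by exists s, [::]; rewrite cats0.
Qed.

End Segments.

(** * Order-shattered families *)

Section OrderShattering.
Context {T : finType}.
Implicit Types (A B S : {set T}) (F D : {set {set T}}).
Local Open Scope nat_scope.

Definition members_within D S : nat := #|[set B in D | B \subset S]|.

Definition trace_set F S : {set {set T}} := [set A :&: S | A in F].

(* Pajor's inequality, with a witnessing family that is also controlled by the
   traces on all subsets: [D] splits along a row [x] into the families of the
   projection and of the link [{A | A, x |: A \in F}]. *)
Lemma order_shattered (l : seq T) F :
  uniq l -> {in F, forall A, A \subset [set x in l]} ->
  exists D,
    [/\ #|D| = #|F|,
        {in D, forall B, B \subset [set x in l] /\ shatters (enum F) B} &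
        forall S, members_within D S <= #|trace_set F S|].
Proof.
rewrite /members_within; elim: l F => [|x l ih] F.
  move=> _ Fl.
  have F0 : forall A, A \in F -> A = finset.set0.
    move=> A /Fl h; apply/eqP; rewrite -finset.subset0.
    suff <- : [set x in [::]] = finset.set0 :> {set T} by [].
    by apply/setP => y; rewrite !inE.
  exists F; split => // [B BF|S].
    split; first exact: Fl.
    apply/shattersP => A; rewrite (F0 _ BF) finset.subset0 => /eqP ->.
    by exists B; rewrite ?mem_enum // finset.setI0.
  have -> : trace_set F S = F.
    rewrite /trace_set -[RHS]imset_id; apply: eq_in_imset => A /F0 -> /=.
    by rewrite finset.set0I.
  by apply: subset_leq_card; apply/fintype.subsetP => B; rewrite inE => /andP[].
move=> /= /andP[xl ul] Fl.
pose F0 : {set {set T}} := [set A :\ x | A in F].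
pose F1 := [set A in F | (x \notin A) && (x |: A \in F)].
have lxl A : x \notin A -> A \subset [set y in x :: l] -> A \subset [set y in l].
  move=> xA /fintype.subsetP h; apply/fintype.subsetP => y yA; have := h y yA.
  by rewrite !inE; case: eqP => // e; rewrite -e yA in xA.
have F0l : {in F0, forall A, A \subset [set x in l]}.
  move=> _ /imsetP[A AF ->]; apply: lxl; first by rewrite !inE eqxx.
  by apply: fintype.subset_trans (Fl _ AF); exact: subD1set.
have F1l : {in F1, forall A, A \subset [set x in l]}.
  by move=> A; rewrite inE => /and3P[AF xA _]; apply: lxl => //; exact: Fl.
have [D0 [c0 s0 t0]] := ih F0 ul F0l.
have [D1 [c1 s1 t1]] := ih F1 ul F1l.
have xD0 B : B \in D0 -> x \notin B.
  move=> /s0[/fintype.subsetP h _]; apply/negP => /h; by rewrite inE (negbTE xl).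
have xD1 B : B \in D1 -> x \notin B.
  move=> /s1[/fintype.subsetP h _]; apply/negP => /h; by rewrite inE (negbTE xl).
pose D := D0 :|: [set x |: B | B in D1].
have inj1 : {in D1 &, injective (fun B => x |: B)}.
  by move=> B B' /xD1 h /xD1 h' e; rewrite -(setU1K h) -(setU1K h') e.
have disj : [disjoint D0 & [set x |: B | B in D1]].
  rewrite -setI_eq0; apply/eqP/setP => B; rewrite !inE; apply/negP.
  move=> /andP[/xD0 h /imsetP[B' _ e]]; by rewrite e !inE eqxx in h.
(* Removing [x] from the members that contain it, and keeping those that avoid it, gives two
   families: their union is the projection and their intersection is the link. *)
have split_card (G : {set {set T}}) :
    #|G| = #|[set A :\ x | A in G]| + #|[set A in G | (x \notin A) && (x |: A \in G)]|.
  pose G' := [set A in G | x \in A]; pose G'' := [set A in G | x \notin A].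
  have e1 : #|G| = #|G'| + #|G''|.
    rewrite -(cardsID [set A : {set T} | x \in A] G); congr (_ + _); apply: eq_card => A;
    by rewrite !inE // andbC.
  have i1 : {in G' &, injective (fun A : {set T} => A :\ x)}.
    move=> A B; rewrite !inE => /andP[_ h] /andP[_ h'] e.
    by rewrite -(finset.setD1K h) -(finset.setD1K h') e.
  have -> : [set A :\ x | A in G] = [set A :\ x | A in G'] :|: G''.
    apply/setP => B; rewrite inE; apply/imsetP/orP.
      move=> [A AG ->]; case xA : (x \in A); [left|right].
        by apply/imsetP; exists A => //; rewrite inE AG xA.
      rewrite inE.
      have -> : A :\ x = A by apply/finset.setDidPl; rewrite disjoint_sym disjoints1 xA.
      by rewrite AG xA.
    case=> [/imsetP[A]|]; rewrite inE => /andP[AG xA].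
      by move=> ->; exists A.
    exists B => //; apply/esym/finset.setDidPl.
    by rewrite disjoint_sym disjoints1.
  have -> : [set A in G | (x \notin A) && (x |: A \in G)]
      = [set A :\ x | A in G'] :&: G''.
    apply/setP => B; rewrite !inE; apply/idP/idP.
      move=> /and3P[BG xB xBG]; rewrite BG xB !andbT.
      apply/imsetP; exists (x |: B); first by rewrite !inE eqxx xBG.
      by rewrite setU1K.
    move=> /and3P[/imsetP[A]]; rewrite inE => /andP[AG xA] -> -> _.
    by rewrite finset.setD1K // AG !inE eqxx.
  by rewrite cardsUI e1 (card_in_imset i1).
have cardD : #|D| = #|F|.
  rewrite cardsU (_ : _ :&: _ = finset.set0); last by apply/eqP; rewrite setI_eq0.
  by rewrite cards0 subn0 (card_in_imset inj1) c0 c1 (split_card F).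
exists D; split => //.
- move=> B; rewrite inE => /orP[BD|/imsetP[B' B'D ->]].
    have [Bl sh] := s0 _ BD; split.
      by apply: fintype.subset_trans Bl _; apply/fintype.subsetP => y; rewrite !inE => ->; rewrite orbT.
    apply/shattersP => A /(shattersP _ _ sh)[C]; rewrite mem_enum.
    move=> /imsetP[C' C'F ->] e; exists C'; first by rewrite mem_enum.
    rewrite -e; apply/setP => y; rewrite !inE.
    case: eqP => [->|//]; by rewrite (negbTE (xD0 _ BD)) !andbF.
  have [Bl sh] := s1 _ B'D; split.
    apply/fintype.subsetP => y; rewrite !inE => /orP[->//|/(fintype.subsetP Bl)].
    by rewrite inE => ->; rewrite orbT.
  apply/shattersP => A Asub.
  have /(shattersP _ _ sh)[C] : A :\ x \subset B' by rewrite subDset.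
  rewrite mem_enum inE => /and3P[CF xC xCF] e.
  case xA : (x \in A).
    exists (x |: C); first by rewrite mem_enum.
    by rewrite -finset.setUIr e finset.setD1K.
  exists C; first by rewrite mem_enum.
  rewrite finset.setIUr e.
  have -> : C :&: [set x] = finset.set0.
    by apply/eqP; rewrite setI_eq0 disjoint_sym disjoints1.
  rewrite finset.set0U; apply/finset.setDidPl; by rewrite disjoint_sym disjoints1 xA.
- move=> S.
  have eD : [set B in D | B \subset S] = [set B in D0 | B \subset S] :|:
      [set x |: B | B in [set B in D1 | x |: B \subset S]].
    apply/setP => B; rewrite !inE andb_orl; congr (_ || _).
    apply/andP/imsetP => [[/imsetP[B' B'D ->] h]|[B']].
      by exists B' => //; rewrite inE B'D.
    rewrite inE => /andP[B'D h] ->; split => //; by apply/imsetP; exists B'.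
  (* If [x] is outside [S], traces do not see it and no set containing [x] lies in [S]. If [x] is in
     [S], the traces split along [x] in the same way as [F], and induction on [S :\ x] bounds each
     part. *)
  case xS : (x \in S); last first.
    have -> : trace_set F S = trace_set F0 S.
      rewrite /trace_set /F0 -imset_comp; apply: eq_imset => A /=.
      apply/setP => y; rewrite !inE; case: eqP => // ->; by rewrite xS !andbF.
    apply: leq_trans (t0 S); apply: subset_leq_card; rewrite eD.
    apply/fintype.subsetP => B /finset.setUP[//|/imsetP[B']].
    by rewrite !inE finset.subUset finset.sub1set xS andbF.
  rewrite (split_card (trace_set F S)) eD.
  apply: leq_trans (leq_card_setU _ _) _; apply: leq_add.
    apply: leq_trans (subset_leq_card _) (leq_trans (t0 (S :\ x)) _).
      apply/fintype.subsetP => B; rewrite !inE => /andP[BD BS]; rewrite BD.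
      by rewrite subsetD1 BS xD0.
    apply: subset_leq_card; apply/fintype.subsetP => _ /imsetP[_ /imsetP[A AF ->] ->].
    apply/imsetP; exists (A :&: S); first exact: imset_f.
    by apply/setP => y; rewrite !inE; case: eqP.
  apply: leq_trans (leq_imset_card _ _) _.
  apply: leq_trans (subset_leq_card _) (leq_trans (t1 (S :\ x)) _).
    apply/fintype.subsetP => B; rewrite !inE finset.subUset => /and3P[BD _ BS]; rewrite BD.
    by rewrite subsetD1 BS xD1.
  apply: subset_leq_card; apply/fintype.subsetP => C /imsetP[A].
  rewrite !inE => /and3P[AF xA xAF] ->.
  have e : A :&: (S :\ x) = A :&: S.
    apply/setP => y; rewrite !inE; case: eqP => // ->; by rewrite (negbTE xA).
  rewrite e; apply/and3P; split.
  + exact: imset_f.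
  + by rewrite inE (negbTE xA).
  + apply/imsetP; exists (x |: A) => //.
    apply/setP => y; rewrite !inE; case: eqP => // ->; by rewrite xS.
Qed.

End OrderShattering.

(** * Degrees in families with few members on small sets *)

Section Degrees.
Context {T : finType}.
Implicit Types (A B S V : {set T}) (F D : {set {set T}}).
Local Open Scope nat_scope.

Definition degree F A : nat := #|[set B in F | A \subset B]|.

(** Double counting of the pairs of a point [v] and a member above [v |: A]. *)
Lemma sum_degree F A V :
  \sum_(v in V) degree F (v |: A) = \sum_(B in F | A \subset B) #|B :&: V|.
Proof.
rewrite /degree; under eq_bigr do rewrite -sum1_card.
rewrite (exchange_big_dep (fun B => (B \in F) && (A \subset B))) /=.
  apply: eq_bigr => B /andP[BF AB]; rewrite -sum1_card; apply: eq_bigl => v.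
  by rewrite !inE finset.subUset finset.sub1set BF AB andbT /= andbC.
by move=> v B _; rewrite inE finset.subUset => /and3P[-> _ ->].
Qed.

(** The [k]-shadow of [D]. When the members of [D] are shattered, so are these sets, and each one
    yields a contribution. *)
Definition subsets_of_size k D : {set {set T}} :=
  [set R : {set T} | (#|R| == k) && [exists B in D, R \subset B]].

Lemma exists_subset_between A B k :
  A \subset B -> #|A| <= k -> k <= #|B| ->
  exists R : {set T}, [/\ A \subset R, R \subset B & #|R| = k].
Proof.
move=> AB Ak kB; elim: k Ak kB => [|k ih] Ak kB.
  by exists A; split => //; apply/eqP; rewrite -leqn0.
move: Ak; rewrite leq_eqVlt => /orP[/eqP e|Ak]; first by exists A.
have [R [AR RB Rk]] := ih Ak (ltnW kB).
have /properP[_ [x xB xR]] : R \proper B by rewrite properEcard RB Rk.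
exists (x |: R); split.
- exact: fintype.subset_trans AR (subsetU1 _ _).
- by rewrite finset.subUset finset.sub1set xB.
- by rewrite cardsU1 xR Rk.
Qed.

Lemma degree_subsets_gt0 k D A : {in D, forall B, k <= #|B|} -> #|A| <= k ->
  0 < degree D A -> 0 < degree (subsets_of_size k D) A.
Proof.
move=> hD Ak /card_gt0P[B]; rewrite inE => /andP[BD AB].
have [R [AR RB Rk]] := exists_subset_between AB Ak (hD _ BD).
apply/card_gt0P; exists R; rewrite !inE Rk eqxx AR andbT.
by apply/existsP; exists B; rewrite BD.
Qed.

End Degrees.

(** * Many [k]-subsets from a bound on members inside small sets *)

Section DegreeBound.
Context {R : realType}.

(** The powers of [y] agree on both sides; what remains on the right is [2 (2b)^e 2^(-(1-e)/g)],
    which is at least 1. Logarithms make this a linear check. It closes the induction step of the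
    degree bound. *)
Lemma powR_step (g y b e : R) : 1 <= g -> 0 < y -> 1 <= b -> 0 <= e <= 1 ->
  y `^ (e + (1 - e) / g)
    <= 8 * b * (y / 2 * (2 * b / (y / 2) `^ g^-1 * y) `^ (e - 1)).
Proof.
move=> g1 y0 b1 /andP[e0 e1].
have g0 : 0 < g by lra.
have b0 : 0 < b by lra.
have y20 : 0 < y / 2 by lra.
have l2 : 0 < ln (2 : R) by apply: ln_gt0; lra.
have lb : 0 <= ln b by apply: ln_ge0.
set z := (y / 2) `^ g^-1.
have z0 : 0 < z by exact: powR_gt0.
have lnz : ln z = (ln y - ln 2) * g^-1.
  by rewrite /z ln_powR lnM ?posrE ?invr_gt0 // lnV ?posrE // mulrC.
clearbody z.
have h1 : 0 < 2 * b / z * y by rewrite mulr_gt0 ?divr_gt0 ?mulr_gt0.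
have h2 : 0 < (2 * b / z * y) `^ (e - 1) by exact: powR_gt0.
rewrite -ler_ln ?posrE ?powR_gt0 ?mulr_gt0 //.
have -> : (8 : R) = 2 * 2 * 2 by ring.
have gi0 : 0 < g^-1 by rewrite invr_gt0.
have gi1 : g^-1 <= 1 by rewrite invf_le1.
rewrite !(ln_powR, lnM, lnV) ?posrE ?mulr_gt0 ?divr_gt0 ?invr_gt0 //.
rewrite lnz.
have h3 : (1 - e) * g^-1 * ln 2 <= ln (2 : R).
  rewrite -[leRHS]mul1r ler_pM2r //.
  by rewrite -[leRHS]mul1r ler_pM ?subr_ge0 // ?(ltW gi0) //; lra.
have h4 : 0 <= e * ln 2 by rewrite mulr_ge0 // ltW.
have h5 : 0 <= e * ln b by rewrite mulr_ge0.
move: h3 h4 h5; move: (ln 2) (ln b) (ln y) (g^-1) => a c d i; nra.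
Qed.

(* Call a point popular if adding it to [A] keeps more than a [2 b / z]
   fraction of the degree of [A]. There are at most [z / 2] popular points,
   so by the trace hypothesis at least half of the members of [D] above [A]
   contain an unpopular one, and the degree splits into small pieces. *)
Lemma degree_bound (T : finType) (k : nat) (D : {set {set T}}) (g K b : R) :
  1 <= g -> g <= k%:R -> 0 < K -> k%:R <= b ->
  {in D, forall B : {set T}, (k <= #|B|)%N} ->
  {in D, forall B : {set T}, #|B|%:R <= b} ->
  (forall S : {set T},
    (members_within D S)%:R <= K * (maxn 1 #|S|)%:R `^ g) ->
  forall j (A : {set T}), (#|A| + j = k)%N -> (0 < degree D A)%N ->
  ((degree D A)%:R / K) `^ (1 - (1 - g^-1) ^+ j)
    <= (degree (subsets_of_size k D) A)%:R * (8 * k%:R * (2 * b) ^+ k) ^+ j.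
Proof.
move=> g1 gk K0 kb Dk Db Dtrace j.
(* Large enough both for the factor [8 b k] lost in an induction step and for the trivial range
   [y < 2 (2b)^g]. *)
set loss := 8 * k%:R * (2 * b) ^+ k.
elim: j => [|j ih] A Aj degA.
  rewrite !expr0 subrr powRr0 mulr1 ler1n; apply: degree_subsets_gt0 => //; lia.
have k0 : (0 < k)%N by lia.
have Ak : (#|A| <= k)%N by lia.
have k1 : 1 <= k%:R :> R by rewrite ler1n.
have b1 : 1 <= b by lra.
have g0 : 0 < g by lra.
have gi0 : 0 < g^-1 by rewrite invr_gt0.
have gi1 : g^-1 <= 1 by rewrite invf_le1.
set w := degree D A; set y := w%:R / K.
have w0 : 0 < w%:R :> R by rewrite ltr0n.
have y0 : 0 < y by rewrite divr_gt0.
pose e : R := 1 - (1 - g^-1) ^+ j.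
have r01 : 0 <= (1 - g^-1) ^+ j <= 1.
  by apply/andP; split; [apply: exprn_ge0|apply: exprn_ile1]; lra.
have e0 : 0 <= e by rewrite /e; lra.
have e1 : e <= 1 by rewrite /e; lra.
(* The recursion of the exponents: one more point closes a fraction [1/g] of the distance to 1. *)
have eE : 1 - (1 - g^-1) ^+ j.+1 = e + (1 - e) / g.
  by rewrite /e exprS; ring.
have bk1 : 1 <= (2 * b) ^+ k by apply: exprn_ege1; lra.
have loss1 : 1 <= loss.
  rewrite /loss; move: k1 bk1; move: (k%:R) ((2 * b) ^+ k) => x t; nra.
have lossb : 8 * b * k%:R <= loss.
  have : b <= (2 * b) ^+ k.
    apply: le_trans (_ : 2 * b <= _); first by clear -b1; lra.
    by apply: ler_eXnr => //; clear -b1; lra.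
  rewrite /loss; move: k1 b1; move: (k%:R) ((2 * b) ^+ k) => x t; clear; nra.
set N := degree (subsets_of_size k D) A.
have N1 : 1 <= N%:R :> R.
  by rewrite ler1n; apply: degree_subsets_gt0.
have lossj : 1 <= loss ^+ j by exact: exprn_ege1.
(* For small [y] the left side is at most [loss], and one [k]-set above [A] suffices. Otherwise
   [z >= 2b], which leaves room for [A] besides the popular points. *)
have [ylt|yge] := ltP (y / 2) ((2 * b) `^ g).
  have E01 : 0 <= 1 - (1 - g^-1) ^+ j.+1 <= 1.
    rewrite eE; move: r01 => _.
    have : 0 <= (1 - e) / g <= 1 - e.
      rewrite mulr_ge0 ?(ltW gi0) ?subr_ge0 //= -[leRHS]mulr1.
      by rewrite ler_wpM2l // subr_ge0.
    lra.
  have yl : y <= loss.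
    have : (2 * b) `^ g <= (2 * b) ^+ k.
      by rewrite -powR_mulrn ?ler_powR //; lra.
    rewrite /loss; move: k1 bk1 ylt; move: (k%:R) ((2 * b) ^+ k) ((2*b) `^ g) => x t u.
    nra.
  have yE : y `^ (1 - (1 - g^-1) ^+ j.+1) <= loss.
    have [y1|y1] := leP y 1.
      apply: le_trans loss1; have := ge0_ler_powR (r := 1 - (1 - g^-1) ^+ j.+1).
      move=> /(_ _ y 1); rewrite powR1; apply => //; rewrite ?nnegrE ?(ltW y0) //.
      by case/andP: E01.
    apply: le_trans yl; rewrite -[leRHS]powRr1 ?(ltW y0) //.
    by apply: ler_powR; [exact: ltW|case/andP: E01].
  apply: le_trans yE _; rewrite exprS.
  have : 0 <= loss * (N%:R * loss ^+ j - 1).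
    rewrite mulr_ge0 ?subr_ge0 //; first lra.
    by rewrite -[leLHS]mul1r ler_pM.
  lra.
(* Chosen so that [K z^g = w / 2]: a set of at most [z] points contains at most half as many members
   as lie above [A]. *)
set z := (y / 2) `^ g^-1.
have y20 : 0 < y / 2 by lra.
have zg : z `^ g = y / 2 by rewrite -powRrM mulVf ?lt0r_neq0 // powRr1 // ltW.
have zb : 2 * b <= z.
  have := ge0_ler_powR (r := g^-1) (ltW gi0) (x := (2 * b) `^ g) (y := y / 2).
  rewrite !nnegrE powR_ge0 (ltW y20) -powRrM mulfV ?lt0r_neq0 // powRr1; last lra.
  by apply.
have z0 : 0 < z by lra.
pose th := 2 * b / z.
have th0 : 0 < th by rewrite divr_gt0 //; lra.
pose P := [set v : T | (v \notin A) && (th * w%:R < (degree D (v |: A))%:R)].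
(* The degrees over [P] sum to at most [w b], since a member has at most [b] points, while each of
   them exceeds [2 b w / z]. *)
have cardP : #|P|%:R <= z / 2.
  have h : #|P|%:R * (th * w%:R) <= w%:R * b.
    apply: (@le_trans _ _ (\sum_(v in P) degree D (v |: A))%:R).
      rewrite natr_sum mulr_natl -sumr_const; apply: ler_sum => v.
      by rewrite inE => /andP[_ /ltW].
    rewrite sum_degree natr_sum.
    apply: (@le_trans _ _ (\sum_(B in D | A \subset B) b)).
      apply: ler_sum => B /andP[BD _]; apply: le_trans (Db _ BD).
      by rewrite ler_nat subset_leq_card // subsetIl.
    rewrite sumr_const mulr_natl le_eqVlt; apply/orP; left; apply/eqP.
    by congr (_ *+ _); apply: eq_card => B; rewrite !inE.
  have : #|P|%:R * (2 * b) <= z * b.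
    have -> : #|P|%:R * (2 * b) = (#|P|%:R * (th * w%:R)) * (z / w%:R).
      by rewrite /th; field; rewrite !lt0r_neq0.
    have -> : z * b = w%:R * b * (z / w%:R) by field; rewrite !lt0r_neq0.
    by rewrite ler_pM2r // divr_gt0.
  move: (#|P|%:R : R) => p; nra.
have cardPA : (maxn 1 #|P :|: A|)%:R <= z.
  have [h|h] := leqP 1 #|P :|: A|; last by lra.
  apply: (@le_trans _ _ (#|P|%:R + #|A|%:R)).
    by rewrite -natrD ler_nat; exact: leq_card_setU.
  have : #|A|%:R <= k%:R :> R by rewrite ler_nat.
  lra.
have small : (members_within D (P :|: A))%:R <= w%:R / 2 :> R.
  apply: (le_trans (Dtrace (P :|: A))).
  have -> : w%:R / 2 = K * z `^ g by rewrite zg /y; field; rewrite lt0r_neq0.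
  rewrite ler_pM2l //; apply: ge0_ler_powR => //; rewrite ?nnegrE ?(ltW g0) ?(ltW z0) //.
pose V := ~: (P :|: A).
(* A member above [A] either lies inside [P :|: A] or contains a point of [V]. *)
have sumV : w%:R / 2 <= (\sum_(v in V) degree D (v |: A))%:R :> R.
  have : (w <= \sum_(v in V) degree D (v |: A) + members_within D (P :|: A))%N.
    rewrite /members_within sum_degree /w /degree.
    rewrite -[X in (X <= _)%N]sum1_card -[X in (_ <= _ + X)%N]sum1_card.
    rewrite (eq_bigl (fun B => (B \in D) && (A \subset B))); last by move=> B; rewrite inE.
    rewrite (bigID (fun B : {set T} => B \subset P :|: A)) /= addnC; apply: leq_add.
      rewrite [X in (_ <= X)%N](bigID (fun B : {set T} => B \subset P :|: A)) /=.
      apply: leq_trans (leq_addl _ _); apply: leq_sum => B /andP[_ h].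
      by rewrite card_gt0 setI_eq0 finset.disjoints_subset finset.setCK.
    rewrite [X in (_ <= X)%N](bigID (fun B : {set T} => A \subset B)) /=.
    apply: leq_trans (leq_addr _ _); apply: eq_leq; apply: eq_bigl => B.
    by rewrite inE; do 2 case: (_ \subset _); rewrite ?andbT ?andbF.
  rewrite -(ler_nat R) natrD; lra.
have Vstep v : v \in V ->
    (degree D (v |: A))%:R / K * (th * y) `^ (e - 1)
      <= (degree (subsets_of_size k D) (v |: A))%:R * loss ^+ j.
  rewrite !inE negb_or negb_and negbK => /andP[h vA].
  move: h; rewrite (negbTE vA) /= -leNgt => h.
  have [->|d0] := posnP (degree D (v |: A)).
    by rewrite !mul0r mulr_ge0 // ; lra.
  apply: le_trans (ih _ _ d0); last by rewrite cardsU1 vA; clear -Aj; lia.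
  rewrite -/e; set d := (degree D (v |: A))%:R / K.
  have d0' : 0 < d by rewrite divr_gt0 // ltr0n.
  have dy : d <= th * y by rewrite /d /y mulrA ler_pM2r // invr_gt0.
  (* Since [e - 1 <= 0], the upper bound [d <= th * y] bounds the second factor from below; the
     first factor can then be summed over [V]. *)
  have -> : d `^ e = d * d `^ (e - 1).
    rewrite -{2}[d]powRr1 ?(ltW d0') // -powRD; first by congr (_ `^ _); ring.
    by rewrite (lt0r_neq0 d0') implybT.
  rewrite ler_pM2l //.
  have -> : e - 1 = - (1 - e) by ring.
  rewrite !powRN lef_pV2 ?posrE ?powR_gt0 ?(lt_le_trans d0' dy) //.
  apply: ge0_ler_powR => //; rewrite ?nnegrE ?(ltW d0') ?subr_ge0 //.
  exact: ltW (lt_le_trans d0' dy).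
(* A [k]-set above [A] is counted once for each of its points in [V], so at most [k] times. *)
have sumN : (\sum_(v in V) degree (subsets_of_size k D) (v |: A) <= k * N)%N.
  rewrite sum_degree; apply: (@leq_trans
    (\sum_(B in subsets_of_size k D | A \subset B) k)%N).
    apply: leq_sum => B /andP[]; rewrite inE => /andP[/eqP <- _] _.
    by rewrite subset_leq_card // subsetIl.
  rewrite sum_nat_const mulnC leq_mul2l; apply/orP; right; apply: eq_leq.
  by rewrite /N /degree cardsE.
have main : y / 2 * (th * y) `^ (e - 1) <= k%:R * N%:R * loss ^+ j.
  apply: (@le_trans _ _ ((\sum_(v in V) degree D (v |: A))%:R / K * (th * y) `^ (e - 1))).
    apply: ler_wpM2r; first exact: powR_ge0.
    have -> : y / 2 = w%:R / 2 / K by rewrite /y; ring.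
    by rewrite ler_pM2r // invr_gt0.
  apply: (@le_trans _ _
    ((\sum_(v in V) degree (subsets_of_size k D) (v |: A))%:R * loss ^+ j)).
    rewrite !natr_sum !mulr_suml; apply: ler_sum => v; exact: Vstep.
  apply: ler_wpM2r; first lra.
  by rewrite -natrM ler_nat.
rewrite eE; apply: le_trans (powR_step g1 y0 b1 _) _; first by rewrite e0.
rewrite -/z -/th exprS.
apply: (@le_trans _ _ (8 * b * (k%:R * N%:R * loss ^+ j))).
  by rewrite ler_pM2l //; lra.
have -> : 8 * b * (k%:R * N%:R * loss ^+ j) = 8 * b * k%:R * (N%:R * loss ^+ j) by ring.
have -> : N%:R * (loss * loss ^+ j) = loss * (N%:R * loss ^+ j) by ring.
by apply: ler_wpM2r => //; rewrite mulr_ge0 //; lra.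
Qed.

End DegreeBound.

(** * Shattered sets of size at least [k] *)

Section ShatteredFamily.
Context {T : finType}.
Implicit Types (k : nat) (A B S : {set T}) (s : seq {set T}).
Local Open Scope nat_scope.

Lemma card_small_subsets k S : 0 < #|S| ->
  #|[set B : {set T} | (B \subset S) && (#|B| < k)]| <= k * #|S| ^ k.-1.
Proof.
move=> S0.
have -> : [set B : {set T} | (B \subset S) && (#|B| < k)]
    = \bigcup_(i < k) [set B : {set T} | (B \subset S) && (#|B| == i)].
  apply/setP => B; rewrite inE; apply/andP/bigcupP => [[BS Bk]|[i _]].
    by exists (Ordinal Bk) => //; rewrite inE BS /=.
  by rewrite inE => /andP[-> /eqP ->].
apply: (@leq_trans (\sum_(i < k) 'C(#|S|, i))).
  elim/big_rec2: _ => [|i n A _ h]; first by rewrite cards0.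
  apply: leq_trans (leq_card_setU _ _) _; rewrite leq_add //.
  by rewrite cards_draws.
rewrite -[k in k * _]card_ord -sum_nat_const; apply: leq_sum => i _.
apply: (@leq_trans (#|S| ^ i)); last by rewrite leq_pexp2l //; have := ltn_ord i; lia.
apply: (@leq_trans (#|S| ^_ i)); last first.
  elim: (i : nat) => [|n h]; first by rewrite ffactn0.
  by rewrite ffactnSr expnSr leq_mul // leq_subr.
by rewrite -bin_ffact leq_pmulr // fact_gt0.
Qed.

(** Order-shattering gives as many sets as there are columns. At most [k |S|^(k-1)] of them have
    fewer than [k] points, so the factor [2 k] leaves enough after these are discarded. *)
Lemma shattered_family k S s :
  uniq s -> {in s, forall A, A \subset S} -> 0 < k -> 0 < #|S| ->
  2 * k * #|S| ^ k.-1 <= size s ->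
  exists D : {set {set T}},
    [/\ #|S| ^ k.-1 <= #|D|,
        {in D, forall B, [/\ k <= #|B|, B \subset S & shatters s B]} &
        forall S', members_within D S' <= #|trace_set [set A in s] S'|].
Proof.
move=> us sS k0 S0 sz.
have eS : [set x in enum S] = S by apply/setP => x; rewrite inE mem_enum.
have [|D [cD sD tD]] := @order_shattered _ (enum S) [set A in s] (enum_uniq _).
  by move=> A; rewrite inE eS; exact: sS.
have cF : #|[set A in s]| = size s by rewrite cardsE; exact/card_uniqP.
exists [set B in D | k <= #|B|]; split.
- pose P := [set B : {set T} | k <= #|B|].
  have := cardsID P D.
  rewrite cD cF => e.
  have h : #|D :\: P| <= k * #|S| ^ k.-1.
    apply: leq_trans (card_small_subsets k S0); apply: subset_leq_card.
    apply/fintype.subsetP => B; rewrite !inE -ltnNge => /andP[-> /sD[+ _]].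
    by rewrite eS => ->.
  have -> : [set B in D | k <= #|B|] = D :&: P.
    by apply/setP => B; rewrite !inE.
  have : #|S| ^ k.-1 <= k * #|S| ^ k.-1 by rewrite leq_pmull.
  have aux a b d x y : 2 * b <= d -> x + y = d -> y <= b -> a <= b -> a <= x.
    by clear; lia.
  by move: sz; rewrite -mulnA => sz; exact: aux sz e h.
- move=> B; rewrite inE => /andP[/sD[+ sh] kB]; rewrite eS => BS; split => //.
  by apply: shatters_subset sh => A; rewrite mem_enum inE.
- move=> S'; apply: leq_trans (tD S'); apply: subset_leq_card.
  by apply/fintype.subsetP => B; rewrite !inE => /andP[/andP[-> _] ->].
Qed.

Lemma card_trace_shattered s B : shatters s B ->
  #|trace_set [set A in s] B| = 2 ^ #|B|.
Proof.
move=> /shattersP h; rewrite -card_powerset; congr #|pred_of_set _|.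
apply/setP => A; rewrite powersetE; apply/imsetP/idP => [[C _ ->]|/h[C Cs <-]].
  exact: subsetIr.
by exists C => //; rewrite inE.
Qed.

End ShatteredFamily.

(** * Guaranteed exponents *)

Section Guarantee.
Context {R : realType}.

(** Cut [s] into [p] blocks of length at least [c] and add up by superadditivity. *)
Lemma total_count_amplify (T : finType) k c (S : {set T}) s p (t : R) :
  (forall s', uniq s' -> {in s', forall A : {set T}, A \subset S} -> (c <= size s')%N ->
     t <= (total_count k S s')%:R) ->
  uniq s -> {in s, forall A : {set T}, A \subset S} -> (p * c <= size s)%N ->
  p%:R * t <= (total_count k S s)%:R.
Proof.
move=> h; elim: p s => [|p ih] s us sS psz; first by rewrite mul0r.
rewrite mulSn in psz.
have es := cat_take_drop c s.
have sub1 := mem_subseq (take_subseq s c).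
have sub2 := mem_subseq (drop_subseq s c).
rewrite -[in leRHS]es mulrS mulrDl mul1r.
apply: le_trans (_ : (total_count k S (take c s) + total_count k S (drop c s))%:R <= _).
  rewrite natrD; apply: lerD.
    apply: h => [|A /sub1/sS //|]; first exact: take_uniq.
    by rewrite size_take; case: ltnP; lia.
  apply: ih => [|A /sub2/sS //|]; first exact: drop_uniq.
  rewrite size_drop; lia.
by rewrite ler_nat total_count_cat.
Qed.

(** The exponent [beta] is attainable. The quantification over all row sets [S] allows the same
    guarantee to be applied to the traces on a subset of the rows. *)
Definition guarantees k (c : nat) (a beta : R) : Prop :=
  forall (T : finType) (S : {set T}) (s : seq {set T}),
    uniq s -> {in s, forall A : {set T}, A \subset S} -> (k <= #|S|)%N ->
    (c * #|S| ^ k.-1 <= size s)%N ->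
    a * #|S|%:R `^ beta <= (total_count k S s)%:R.

(** A constant factor in the contributions is bought with a constant factor in the columns. *)
Lemma guarantees_amplify k c (a beta : R) : 0 < a -> guarantees k c a beta ->
  exists c', guarantees k c' 1 beta.
Proof.
move=> a0 h; pose p := (Num.truncn a^-1).+1.
have pa : 1 <= p%:R * a.
  by rewrite -ler_pdivrMr // mul1r ltW // truncnS_gt.
exists (p * c)%N => T S s us sS kS sz.
apply: le_trans (_ : p%:R * (a * #|S|%:R `^ beta) <= _).
  by rewrite mulrA ler_wpM2r // powR_ge0.
apply: (@total_count_amplify _ _ (c * #|S| ^ k.-1)%N) => //.
  by move=> s' us' sS' sz'; apply: h.
by rewrite mulnA.
Qed.

(** Start of the iteration: exponent 0 asks for a single shattered [k]-set, found inside any member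
    of the shattered family. *)
Lemma guarantees0 k : (0 < k)%N -> guarantees k (2 * k) 1 0.
Proof.
move=> k0 T S s us sS kS sz; rewrite powRr0 mulr1 ler1n.
have S0 : (0 < #|S|)%N by lia.
have [D [cD hD _]] := shattered_family us sS k0 S0 sz.
have /card_gt0P[B /hD[kB BS sB]] : (0 < #|D|)%N.
  by apply: leq_trans cD; rewrite expn_gt0 S0.
have [|Q [_ QB Qk]] := @exists_subset_between _ finset.set0 B k (finset.sub0set _) _ kB.
  by rewrite cards0.
apply: leq_trans (shattered_leq_total_count _ _ _); apply/card_gt0P; exists Q.
by rewrite inE Qk eqxx (fintype.subset_trans QB BS) (shatters_subr QB sB).
Qed.

(** Every [c |S'|^(k-1)] distinct traces make [|S'|^beta] contributions, all of which come from [s];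
    so only about [X / |S'|^beta] such blocks fit, where [X] is the total count. The summand [2 ^ k]
    covers sets [S'] too small for the guarantee. *)
Lemma trace_bound k c (beta : R) (T : finType) (S : {set T}) s (S' : {set T}) :
  (0 < k)%N -> (0 < c)%N -> 0 <= beta -> beta <= (k.-1)%:R ->
  guarantees k c 1 beta ->
  uniq s -> {in s, forall A : {set T}, A \subset S} -> (k <= #|S|)%N ->
  (c * #|S| ^ k.-1 <= size s)%N -> (1 <= total_count k S s)%N -> S' \subset S ->
  #|trace_set [set A in s] S'|%:R
    <= (2 * c + 2 ^ k)%:R * (total_count k S s)%:R
         * (maxn 1 #|S'|)%:R `^ ((k.-1)%:R - beta).
Proof.
move=> k0 c0 beta0 betak hc us sS kS sz X1 S'S.
set X := total_count k S s in X1 *.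
set t := undup [seq A :&: S' | A <- s].
have -> : #|trace_set [set A in s] S'| = size t.
  rewrite -(card_uniqP (undup_uniq _)); apply: eq_card => A.
  rewrite mem_undup; apply/imsetP/mapP => [[C + ->]|[C Cs ->]].
    by rewrite inE => Cs; exists C.
  by exists C => //; rewrite inE.
have tS' : {in t, forall A : {set T}, A \subset S'}.
  by move=> A; rewrite mem_undup => /mapP[C _ ->]; exact: subsetIr.
set g := (k.-1)%:R - beta.
have g0 : 0 <= g by rewrite subr_ge0.
have X1' : 1 <= X%:R :> R by rewrite ler1n.
have max1 : 1 <= (maxn 1 #|S'|)%:R :> R by rewrite ler1n leq_maxl.
have pow1 : 1 <= (maxn 1 #|S'|)%:R `^ g by have := ler_powR max1 g0; rewrite powRr0.
have [S'k|kS'] := ltnP #|S'| k.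
  have h : (size t <= 2 ^ k)%N.
    rewrite -(card_uniqP (undup_uniq _)).
    apply: leq_trans (_ : #|powerset S'| <= _)%N.
      by apply: subset_leq_card; apply/fintype.subsetP => A /tS'; rewrite powersetE.
    by rewrite card_powerset leq_exp2l // ltnW.
  rewrite -mulrA; apply: le_trans (_ : (2 * c + 2 ^ k)%:R * 1 <= _).
    by rewrite mulr1 ler_nat; lia.
  rewrite ler_wpM2l //; rewrite -[leLHS]mulr1 ler_pM //.
have S'0 : (0 < #|S'|)%N by lia.
have -> : maxn 1 #|S'| = #|S'| by apply/maxn_idPr.
have S'0' : 0 < #|S'|%:R :> R by rewrite ltr0n.
pose q := (c * #|S'| ^ k.-1)%N.
have q0 : (0 < q)%N by rewrite /q muln_gt0 c0 expn_gt0 S'0.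
have qE : q%:R = c%:R * (#|S'|%:R `^ beta * #|S'|%:R `^ g) :> R.
  rewrite -powRD; last by rewrite (lt0r_neq0 S'0') implybT.
  by rewrite /g addrC subrK powR_mulrn // natrM natrX.
have hp : (size t %/ q)%:R * #|S'|%:R `^ beta <= X%:R.
  apply: le_trans (_ : (total_count k S' t)%:R <= _); last first.
    by rewrite ler_nat total_count_trace.
  apply: (@total_count_amplify _ _ q) => //; last exact: leq_divM.
    by move=> s' us' sS' sz'; rewrite -[leLHS]mul1r; apply: hc.
  exact: undup_uniq.
(* This pays for the last, incomplete block of traces. *)
have hS : #|S'|%:R `^ beta <= X%:R.
  apply: le_trans (_ : #|S|%:R `^ beta <= _).
    by rewrite ge0_ler_powR // ?nnegrE // ler_nat subset_leq_card.
  by rewrite -[leLHS]mul1r; apply: hc.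
have ht : (size t)%:R <= ((size t %/ q)%:R + 1) * q%:R :> R.
  by rewrite natr1 -natrM ler_nat ltnW // ltn_ceil.
apply: le_trans ht _; rewrite qE.
have -> : ((size t %/ q)%:R + 1) * (c%:R * (#|S'|%:R `^ beta * #|S'|%:R `^ g))
   = c%:R * ((size t %/ q)%:R * #|S'|%:R `^ beta + #|S'|%:R `^ beta) * #|S'|%:R `^ g.
  by ring.
rewrite ler_wpM2r ?powR_ge0 // natrD natrM.
apply: (@le_trans _ _ (c%:R * (X%:R + X%:R))).
  by rewrite ler_wpM2l // lerD.
rewrite (_ : (2 * c%:R + (2 ^ k)%:R) * X%:R
  = c%:R * (X%:R + X%:R) + (2 ^ k)%:R * X%:R :> R); last by ring.
by rewrite lerDl mulr_ge0.
Qed.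

End Guarantee.

(** * Estimates for improving an exponent *)

Section Improvement.
Context {R : realType}.

(** By Bernoulli [(1 + 1/g)^n >= 2], and its product with [(1 - 1/g)^n] is at most 1. *)
Lemma exp_one_sub_inv_le_half n (g : R) : 1 <= g -> g <= n%:R ->
  (1 - g^-1) ^+ n <= 2^-1.
Proof.
move=> g1 gn.
have g0 : 0 < g by lra.
have gi0 : 0 < g^-1 by rewrite invr_gt0.
have gi1 : g^-1 <= 1 by rewrite invf_le1.
have bernoulli : 1 + n%:R * g^-1 <= (1 + g^-1) ^+ n.
  elim: n {gn} => [|n ih]; first by rewrite mul0r addr0 expr0.
  rewrite exprS -natr1; apply: le_trans (_ : (1 + g^-1) * (1 + n%:R * g^-1) <= _).
    have : 0 <= n%:R * g^-1 * g^-1 by rewrite !mulr_ge0 // ltW.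
    by move: (n%:R : R) (g^-1) => x i; clear; lra.
  by rewrite ler_pM2l // addr_gt0.
have two : 2 <= (1 + g^-1) ^+ n.
  apply: le_trans bernoulli.
  have : 1 <= n%:R * g^-1 by rewrite ler_pdivlMr ?mul1r.
  by clear; lra.
have r0 : 0 <= (1 - g^-1) ^+ n by rewrite exprn_ge0 // subr_ge0.
have : (1 - g^-1) ^+ n * (1 + g^-1) ^+ n <= 1.
  rewrite -exprMn; apply: exprn_ile1.
    by rewrite mulr_ge0 ?subr_ge0 // addr_ge0 // ltW.
  have : 0 <= g^-1 * g^-1 by rewrite mulr_ge0 // ltW.
  by move: (g^-1) => i; clear; lra.
have : (1 - g^-1) ^+ n * 2 <= (1 - g^-1) ^+ n * (1 + g^-1) ^+ n.
  by rewrite ler_wpM2l.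
by clear; lra.
Qed.

(** One factor [1 - 1/g] is kept exactly and the other [k] contribute at most one half. *)
Lemma one_sub_exp_ge k (g : R) : 1 <= g -> g <= k%:R ->
  (g + 1) / (2 * g) <= 1 - (1 - g^-1) ^+ k.+1.
Proof.
move=> g1 gk; have h := exp_one_sub_inv_le_half g1 gk.
have g0 : 0 < g by lra.
have gi1 : g^-1 <= 1 by rewrite invf_le1.
have : (1 - g^-1) ^+ k.+1 <= (1 - g^-1) * 2^-1.
  by rewrite exprS ler_wpM2l // subr_ge0.
have -> : (g + 1) / (2 * g) = 1 - (1 - g^-1) * 2^-1 by field; exact: lt0r_neq0.
by clear; lra.
Qed.

Lemma expn_leq_expn2 N n : (n ^ N <= N ^ N * 2 ^ n)%N.
Proof.
have [->|N0] := posnP N; first by rewrite !expn0 mul1n expn_gt0.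
have h : (n <= N * 2 ^ (n %/ N))%N.
  apply: leq_trans (ltnW (ltn_ceil n N0)) _.
  by rewrite mulnC leq_mul2l ltn_expl ?orbT.
apply: (@leq_trans ((N * 2 ^ (n %/ N)) ^ N)); first by rewrite leq_exp2r.
by rewrite expnMn leq_mul2l -expnM leq_pexp2l ?orbT // leq_divM.
Qed.

(** Shattered sets have size [m^o(1)]: an exponential bound beats any power, so [A] enters only
    through its [N]-th root. Compare [n^(N+k)] with [2^n] and cancel [n^k]. *)
Lemma le_powR_of_exp_le (n N k : nat) (A : R) :
  (0 < N)%N -> (0 < n)%N -> 0 <= A -> 2 ^+ n <= A * n%:R ^+ k ->
  n%:R <= (((N + k) ^ (N + k))%:R * A) `^ N%:R^-1.
Proof.
move=> N0 n0 A0 h.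
have n0' : 0 < n%:R :> R by rewrite ltr0n.
have N0' : 0 < N%:R :> R by rewrite ltr0n.
have h1 : n%:R ^+ N <= ((N + k) ^ (N + k))%:R * A.
  rewrite -(ler_pM2r (exprn_gt0 k n0')) -exprD -mulrA.
  apply: le_trans (_ : ((N + k) ^ (N + k))%:R * 2 ^+ n <= _).
    by rewrite -!natrX -natrM ler_nat expn_leq_expn2.
  by rewrite ler_wpM2l.
have -> : n%:R = (n%:R ^+ N) `^ N%:R^-1 :> R.
  by rewrite -powR_mulrn // -powRrM mulfV ?lt0r_neq0 // powRr1.
by apply: ge0_ler_powR; rewrite ?nnegrE ?invr_ge0 ?exprn_ge0 ?mulr_ge0.
Qed.

(** Solves, in logarithmic form, an inequality with the number of contributions on both sides: [x]
    stands for [ln X] and [L] for [ln m]. *)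
Lemma le_of_self_bound (L x c1 c3 e p q d : R) : 0 <= L -> 0 <= c1 -> 0 <= c3 ->
  0 <= e -> q * (1 + e) <= e * p - d ->
  e * (p * L - c1 - x) <= x + c3 + d * L -> q * L - c1 - c3 <= x.
Proof.
move=> L0 c10 c30 e0 hq h.
have h1 : 0 <= L * (e * p - d - q * (1 + e)) by rewrite mulr_ge0 ?subr_ge0.
have h2 : 0 <= e * c3 by rewrite mulr_ge0.
have e1 : 0 < 1 + e by lra.
rewrite -subr_ge0 -(pmulr_rge0 _ e1); move: h h1 h2 c10; clear; lra.
Qed.

Lemma guarantees_mono k c c' (a beta : R) : (c <= c')%N ->
  guarantees k c a beta -> guarantees k c' a beta.
Proof.
move=> cc' h T S s us sS kS sz; apply: h => //.
by apply: leq_trans sz; rewrite leq_mul2r cc' orbT.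
Qed.

(** Collects the hypotheses of the degree bound, with the total count as parameter. The last item
    holds because a shattered [B] has [2^|B|] traces, to which the trace bound applies. *)
Lemma shattered_family_bounds k c (beta : R) (T : finType) (S : {set T}) s :
  (0 < k)%N -> (2 * k <= c)%N -> 0 <= beta -> beta <= (k.-1)%:R ->
  guarantees k c 1 beta ->
  uniq s -> {in s, forall A : {set T}, A \subset S} -> (k <= #|S|)%N ->
  (c * #|S| ^ k.-1 <= size s)%N ->
  exists D : {set {set T}},
    [/\ (#|S| ^ k.-1 <= #|D|)%N,
        {in D, forall B : {set T}, (k <= #|B|)%N},
        (forall A, (degree (subsets_of_size k D) A <= total_count k S s)%N),
        (forall A : {set T}, (members_within D A)%:R
          <= (2 * c + 2 ^ k)%:R * (total_count k S s)%:R
             * (maxn 1 #|A|)%:R `^ ((k.-1)%:R - beta)) &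
        {in D, forall B : {set T}, (2 : R) ^+ #|B|
          <= (2 * c + 2 ^ k)%:R * (total_count k S s)%:R * #|B|%:R ^+ k}].
Proof.
move=> k0 ck beta0 betak hc us sS kS sz.
have S0 : (0 < #|S|)%N by apply: leq_trans kS.
have c0 : (0 < c)%N by apply: leq_trans ck; rewrite muln_gt0.
have X1 : (1 <= total_count k S s)%N.
  have h := @guarantees0 R k k0.
  have := guarantees_mono ck h us sS kS sz.
  by rewrite powRr0 mulr1 ler1n.
have sz2 : (2 * k * #|S| ^ k.-1 <= size s)%N.
  by apply: leq_trans sz; rewrite leq_mul2r ck orbT.
have tb (S' : {set T}) (h : S' \subset S) :=
  @trace_bound R k c beta T S s S' k0 c0 beta0 betak hc us sS kS sz X1 h.
have [D [cD hD tD]] := shattered_family us sS k0 S0 sz2.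
have gk0 : 0 <= (k.-1)%:R - beta by rewrite subr_ge0.
exists D; split => //.
- by move=> B /hD[].
- move=> A; apply: leq_trans (shattered_leq_total_count _ _ _).
  apply: subset_leq_card; apply/fintype.subsetP => Q; rewrite !inE.
  move=> /andP[/andP[-> /existsP[B /andP[/hD[_ BS sB] QB]]] _].
  by rewrite (fintype.subset_trans QB BS) (shatters_subr QB sB).
- move=> A; apply: le_trans (_ : (members_within D (A :&: S))%:R <= _).
    rewrite ler_nat; apply: subset_leq_card; apply/fintype.subsetP => B; rewrite !inE.
    by move=> /andP[BD BA]; rewrite BD finset.subsetI BA; have [] := hD _ BD.
  apply: le_trans (_ : #|trace_set [set B in s] (A :&: S)|%:R <= _).
    by rewrite ler_nat tD.
  apply: le_trans (tb _ (subsetIr _ _)) _.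
  rewrite ler_wpM2l ?mulr_ge0 // ge0_ler_powR ?nnegrE // ler_nat.
  by rewrite geq_max leq_max leqnn /= leq_max (subset_leq_card (subsetIl _ _)) orbT.
- move=> B /hD[kB BS sB]; rewrite -natrX -(card_trace_shattered sB).
  apply: le_trans (tb _ BS) _; rewrite ler_wpM2l ?mulr_ge0 //.
  have B0 : (0 < #|B|)%N by apply: leq_trans kB.
  rewrite (maxn_idPr B0) -powR_mulrn // ler_powR ?ler1n //.
  apply: le_trans (_ : (k.-1)%:R <= _); first by rewrite gerBl.
  by rewrite ler_nat leq_pred.
Qed.

End Improvement.

(** * Halving the gap to [k/3] and iterating *)

Section Iteration.
Context {R : realType}.

(** The old exponent limits the traces, hence the members inside small sets; the degree bound above
    the empty set then bounds [X] below by a power of [m^(k-1) / X]. Solving for [X] halves the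
    gap. *)
Lemma guarantees_step_const k c (u : R) : (3 <= k)%N -> (2 * k <= c)%N ->
  0 < u -> u <= k%:R / 3 -> guarantees k c 1 (k%:R / 3 - u) ->
  exists2 a : R, 0 < a & guarantees k c a (k%:R / 3 - u / 2).
Proof.
move=> k3 ck u0 uk hc.
have k0 : (0 < k)%N by lia.
have k3' : 3 <= k%:R :> R by rewrite (ler_nat R 3).
have kE : (k.-1)%:R = k%:R - 1 :> R by rewrite -[in RHS](prednK k0) -natr1 addrK.
pose beta : R := k%:R / 3 - u.
pose beta' : R := k%:R / 3 - u / 2.
pose g : R := (k.-1)%:R - beta.
have gE : g = 2 * k%:R / 3 - 1 + u by rewrite /g /beta kE; field.
have g1 : 1 <= g by lra.
have gk : g <= (k.-1)%:R by rewrite kE; lra.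
have beta0 : 0 <= beta by rewrite /beta; lra.
have betak : beta <= (k.-1)%:R by rewrite kE /beta; lra.
(* Member sizes will be bounded by a multiple of [m^(k/N)], and the degree bound loses this to the
   power [k^2]; with this [N] the loss is at most [m^(u/4)] up to a constant. *)
pose N := (Num.truncn (4 * k%:R ^+ 3 / u)).+1.
have N0 : (0 < N)%N by [].
have N0' : 0 < N%:R :> R by rewrite ltr0n.
have NE : k%:R / N%:R * (k * k)%:R <= u / 4.
  have : 4 * k%:R ^+ 3 / u <= N%:R by rewrite ltW // truncnS_gt.
  rewrite ler_pdivrMr // natrM mulrAC ler_pdivrMr // => h.
  by move: h; rewrite !exprS expr0; clear; lra.
pose C1 : R := (2 * c + 2 ^ k)%:R.
have C1ge : 1 <= C1 by rewrite ler1n addn_gt0 expn_gt0 orbT.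
pose C2 : R := k%:R + (((N + k) ^ (N + k))%:R * C1) `^ N%:R^-1.
have C2k : k%:R <= C2 by rewrite lerDl powR_ge0.
have C2ge : 1 <= C2 by lra.
pose C3 : R := (8 * k%:R * (2 * C2) ^+ k) ^+ k.
have C3ge : 1 <= C3.
  apply: exprn_ege1; rewrite -[leLHS]mul1r ler_pM //; first by clear -k3'; lra.
  by apply: exprn_ege1; clear -C2ge; lra.
have C10 : 0 < C1 by apply: lt_le_trans C1ge.
have C30 : 0 < C3 by apply: lt_le_trans C3ge.
exists (C1^-1 * C3^-1); first by rewrite mulr_gt0 ?invr_gt0.
have C1i : C1^-1 <= 1 by rewrite invf_le1.
have C3i : C3^-1 <= 1 by rewrite invf_le1.
move=> T S s us sS kS sz.
have [D [cD Dk degX withinX shX]] :=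
  shattered_family_bounds k0 ck beta0 betak hc us sS kS sz.
set X := total_count k S s in degX withinX shX *.
set m : R := #|S|%:R.
have m1 : 1 <= m by rewrite ler1n; apply: leq_trans kS.
have m0 : 0 < m by apply: lt_le_trans m1.
have D0 : (0 < #|D|)%N.
  by apply: leq_trans cD; rewrite expn_gt0; apply/orP; left; apply: leq_trans kS.
have degA0 : (0 < degree D finset.set0)%N.
  apply: leq_trans D0 _; apply: subset_leq_card.
  by apply/fintype.subsetP => B BD; rewrite inE BD finset.sub0set.
have cards0k : (#|@finset.set0 T| + k = k)%N by rewrite cards0.
have X1 : 1 <= X%:R :> R.
  rewrite ler1n; apply: leq_trans (degX finset.set0).
  by apply: degree_subsets_gt0 Dk _ degA0; rewrite -[X in (_ <= X)%N]cards0k leq_addr.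
have X0 : 0 < X%:R :> R by apply: lt_le_trans X1.
have small_exp (n : nat) : beta' <= n%:R -> C1^-1 * C3^-1 * m `^ beta' <= C1^-1 * m ^+ n.
  move=> bn; rewrite -mulrA ler_pM2l ?invr_gt0 //.
  rewrite -[leRHS]mul1r; apply: ler_pM; rewrite ?invr_ge0 ?powR_ge0 ?(ltW C30) //.
  by rewrite -powR_mulrn ?(ltW m0) // ler_powR.
have b'k1 : beta' <= (k.-1)%:R by rewrite kE /beta'; clear -k3' u0 uk; lra.
(* With [X >= m^k] there is nothing to do. Otherwise [X] can be replaced by [m^k] in the bound on
   member sizes. *)
have [Xk|Xk] := leP (m ^+ k) X%:R.
  apply: le_trans (small_exp k _) _.
    by apply: le_trans b'k1 _; rewrite ler_nat leq_pred.
  apply: le_trans Xk; rewrite -[leRHS]mul1r ler_wpM2r // exprn_ge0 // ltW.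
pose mu := m `^ (k%:R / N%:R).
have mu1 : 1 <= mu.
  have := @ler_powR R m m1 0 (k%:R / N%:R); rewrite powRr0; apply.
  by rewrite divr_ge0.
pose b := C2 * mu.
have bk : k%:R <= b.
  by apply: le_trans C2k _; rewrite -[leLHS]mulr1 ler_pM2l // (lt_le_trans _ C2ge).
have Db : {in D, forall B : {set T}, #|B|%:R <= b}.
  move=> B BD; have B0 : (0 < #|B|)%N by apply: leq_trans (Dk _ BD).
  have h : 2 ^+ #|B| <= C1 * m ^+ k * #|B|%:R ^+ k.
    apply: le_trans (shX _ BD) _; rewrite ler_wpM2r ?exprn_ge0 //.
    by rewrite ler_pM2l // ltW.
  have Cm0 : 0 <= C1 * m ^+ k by rewrite mulr_ge0 ?exprn_ge0 // ltW.
  apply: le_trans (le_powR_of_exp_le N0 B0 Cm0 h) _.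
  rewrite mulrA powRM ?mulr_ge0 ?exprn_ge0 ?(ltW C10) ?(ltW m0) //.
  rewrite -[m ^+ k]powR_mulrn ?(ltW m0) // -powRrM -/mu /b.
  by rewrite ler_pM2r ?(lt_le_trans _ mu1) // /C2 lerDr.
have K0 : 0 < C1 * X%:R by rewrite mulr_gt0.
have gk' : g <= k%:R by apply: le_trans gk _; rewrite ler_nat leq_pred.
have main := degree_bound g1 gk' K0 bk Dk Db withinX cards0k degA0.
have lossE : (8 * k%:R * (2 * b) ^+ k) ^+ k <= C3 * m `^ (u / 4).
  have -> : (8 * k%:R * (2 * b) ^+ k) ^+ k = C3 * mu ^+ (k * k).
    by rewrite /C3 /b [2 * (C2 * mu)]mulrA [(2 * C2 * mu) ^+ k]exprMn mulrA [mu ^+ (k * k)]exprM -[RHS]exprMn.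
  rewrite ler_pM2l // -powR_mulrn ?powR_ge0 // -powRrM ler_powR //.
pose y := m ^+ k.-1 / (C1 * X%:R).
have y0 : 0 < y by rewrite divr_gt0 ?exprn_gt0.
have yD : y <= (degree D finset.set0)%:R / (C1 * X%:R).
  rewrite ler_pM2r ?invr_gt0 // -natrX ler_nat; apply: leq_trans cD _.
  apply: subset_leq_card; apply/fintype.subsetP => B BD; by rewrite inE BD finset.sub0set.
(* If [y < 1], then [C1 * X] exceeds [m^(k-1)], which is enough. If [y >= 1], the exponent of [y]
   may be lowered to [e]. *)
have [y1|y1] := leP 1 y; last first.
  apply: le_trans (small_exp _ b'k1) _.
  rewrite mulrC ler_pdivrMr // mulrC.
  by move: y1; rewrite /y ltr_pdivrMr // mul1r => /ltW.
pose e : R := (g + 1) / (2 * g).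
have g0 : 0 < g by clear -g1; lra.
have e0 : 0 <= e by rewrite divr_ge0 //; clear -g0; lra.
have ek : e <= 1 - (1 - g^-1) ^+ k.
  by have := one_sub_exp_ge g1 gk; rewrite prednK.
have Xbound : y `^ e <= X%:R * (C3 * m `^ (u / 4)).
  apply: le_trans (ler_powR y1 ek) _.
  apply: (le_trans (ge0_ler_powR (le_trans e0 ek) _ _ yD)).
  - by rewrite nnegrE ltW.
  - by rewrite nnegrE ltW // (lt_le_trans y0).
  apply: (le_trans main); apply: ler_pM => //; last by rewrite ler_nat.
  have b0 : 0 <= b by apply: le_trans bk.
  by apply: exprn_ge0; apply: mulr_ge0; [exact: mulr_ge0 | apply: exprn_ge0; exact: mulr_ge0].
(* The difference is a multiple of [u / g] with factor [(2k/3 - 3/2 + u) / 2], positive for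
   [k >= 3]: a new gap [u / 2] leaves room for the loss [u / 4]. *)
have exponents : beta' * (1 + e) <= e * (k.-1)%:R - u / 4.
  rewrite -subr_ge0.
  have -> : e * (k.-1)%:R - u / 4 - beta' * (1 + e)
      = ((2 * k%:R / 3 - 3 / 2 + u) * u / 2) / g.
    have uE : u = g - (2 * k%:R / 3 - 1) by rewrite gE; ring.
    by rewrite /e /beta' kE uE; field; rewrite lt0r_neq0.
  by rewrite !divr_ge0 ?mulr_ge0 ?(ltW u0) ?(ltW g0) //; clear -k3' u0; lra.
have mln : 0 <= ln m by exact: ln_ge0.
have C1ln : 0 <= ln C1 by exact: ln_ge0.
have C3ln : 0 <= ln C3 by exact: ln_ge0.
have P0 : 0 < m `^ (u / 4) by exact: powR_gt0.
have mk0 : 0 < m ^+ k.-1 by exact: exprn_gt0.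
have : ln (y `^ e) <= ln (X%:R * (C3 * m `^ (u / 4))).
  by rewrite ler_ln ?posrE //; [exact: powR_gt0 | rewrite !mulr_gt0].
rewrite ln_powR /y !lnM ?posrE ?invr_gt0 ?mulr_gt0 // lnV ?posrE //.
rewrite lnM ?posrE // lnXn // ln_powR -[ln m *+ _]mulr_natl opprD !addrA => lnXbound.
rewrite -ler_ln ?posrE ?mulr_gt0 ?invr_gt0 ?powR_gt0 //.
rewrite !lnM ?posrE ?mulr_gt0 ?invr_gt0 ?powR_gt0 // !lnV ?posrE // ln_powR.
have := le_of_self_bound mln C1ln C3ln e0 exponents lnXbound.
by rewrite -/beta'; clear; lra.
Qed.

Lemma guarantees_step k (u : R) : (3 <= k)%N -> 0 < u -> u <= k%:R / 3 ->
  (exists c, guarantees k c 1 (k%:R / 3 - u)) ->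
  exists c, guarantees k c 1 (k%:R / 3 - u / 2).
Proof.
move=> k3 u0 uk [c hc].
have ck : (2 * k <= c + 2 * k)%N by rewrite leq_addl.
have [a a0 ha] :=
  guarantees_step_const k3 ck u0 uk (guarantees_mono (leq_addr _ _) hc).
exact: guarantees_amplify a0 ha.
Qed.

Lemma guarantees_third k (eps : R) : (3 <= k)%N -> 0 < eps ->
  exists c, guarantees k c 1 (k%:R / 3 - eps).
Proof.
move=> k3 eps0.
have k0 : 0 < k%:R / 3 :> R by rewrite divr_gt0 // ltr0n; lia.
have half n : exists c, guarantees k c (1 : R) (k%:R / 3 - k%:R / 3 / 2 ^+ n).
  elim: n => [|n ih].
    rewrite expr0 divr1 subrr; exists (2 * k)%N; apply: guarantees0; lia.
  have -> : k%:R / 3 / 2 ^+ n.+1 = k%:R / 3 / 2 ^+ n / 2 :> R.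
    by rewrite exprSr invfM mulrA.
  apply: guarantees_step => //; first by rewrite divr_gt0 ?exprn_gt0.
  by rewrite ler_pdivrMr ?exprn_gt0 // -[leLHS]mulr1 ler_pM2l // exprn_ege1 // ler1n.
(* As [2^n > n], this many halvings bring the initial gap [k/3] below [eps]. *)
pose n := (Num.truncn (k%:R / 3 / eps)).+1.
have hn : k%:R / 3 / 2 ^+ n <= eps.
  rewrite ler_pdivrMr ?exprn_gt0 // [eps * _]mulrC -ler_pdivrMr //.
  apply: le_trans (_ : n%:R <= _); first by rewrite ltW // truncnS_gt.
  by rewrite -natrX ler_nat ltnW // ltn_expl.
have [c hc] := half n; exists c => T S s us sS kS sz.
apply: le_trans (hc _ _ _ us sS kS sz).
rewrite !mul1r; apply: ler_powR; last by rewrite lerD2l lerN2.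
by rewrite ler1n (leq_trans (ltnW (ltnW k3)) kS).
Qed.

End Iteration.

(** * From column sequences to matrices *)

Section Matrices.
Variables (m n : nat) (M : 'M[bool]_(m, n)).
Local Open Scope nat_scope.

Definition column_set (j : 'I_n) : {set 'I_m} := [set i | M i j].

Lemma column_set_inj : simple_mx M -> injective column_set.
Proof.
move=> hM i j /setP e; apply: hM; apply/matrixP => x y; rewrite !mxE.
by have := e x; rewrite !inE.
Qed.

Lemma simple_submatrix (Q : {set 'I_m}) (C : {set 'I_n}) :
  {in C &, injective (fun j => column_set j :&: Q)} ->
  simple_mx (submatrix M Q C).
Proof.
move=> hC i j /matrixP e; apply: enum_val_inj; apply: hC; try exact: enum_valP.
apply/setP => x; rewrite !inE; have [xQ|//] := boolP (x \in Q); rewrite ?andbF //.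
have := e (enum_rank_in xQ x) ord0; rewrite !mxE enum_rankK_in // => ->.
by [].
Qed.

Definition separated (C C' : {set 'I_n}) : Prop :=
  max_idx C < min_idx C' \/ max_idx C' < min_idx C.

Lemma max_idx_lt_min_idx (C C' : {set 'I_n}) :
  C != finset.set0 -> C' != finset.set0 -> {in C & C', forall i j : 'I_n, i < j} ->
  max_idx C < min_idx C'.
Proof.
move=> C0 /set0Pn[j0 j0C'] h.
have lt j : j \in C' -> max_idx C < j.
  move=> jC'; have /set0Pn[i0 i0C] := C0.
  (* The default value 0 of the maximum is below [j] because some element of [C] is. *)
  rewrite /max_idx; elim/big_ind: _ => [|x y hx hy|i iC]; last exact: h.
    exact: leq_ltn_trans (leq0n _) (h _ _ i0C jC').
  by rewrite gtn_max hx.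
(* The default value [n] of the minimum is handled by an element of [C'], itself below [n]. *)
rewrite /min_idx; elim/big_ind: _ => //.
- exact: ltn_trans (lt _ j0C') (ltn_ord j0).
- by move=> x y hx hy; rewrite leq_min hx.
Qed.

(** From the first block pick one column for each subset of [Q]: these [2^k] columns are distinct on
    [Q] and precede everything chosen from later blocks. *)
Lemma segments_contributions k (Q : {set 'I_m}) p (l : seq 'I_n) :
  #|Q| = k -> sorted (fun i j : 'I_n => i < j) l ->
  segments Q p [seq column_set j | j <- l] ->
  exists CC : {set {set 'I_n}},
    [/\ #|CC| = p,
        {in CC, forall C : {set 'I_n}, [/\ #|C| = 2 ^ k, {subset C <= l} &
          simple_mx (submatrix M Q C)]} &
        {in CC &, forall C C' : {set 'I_n}, C <> C' -> separated C C'}].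
Proof.
move=> Qk; elim: p l => [|p ih] l sl /=.
  by move=> _; exists finset.set0; split=> [|C|C C']; rewrite ?cards0 ?inE.
move=> [s1 [s2 [e /shattersP sh seg]]].
pose l1 := take (size s1) l; pose l2 := drop (size s1) l.
have e1 : [seq column_set j | j <- l1] = s1 by rewrite map_take e take_size_cat.
have e2 : [seq column_set j | j <- l2] = s2 by rewrite map_drop e drop_size_cat.
have ltr : transitive (fun i j : 'I_n => i < j) by move=> y x z; exact: ltn_trans.
have [srt2 lt12] : sorted (fun i j : 'I_n => i < j) l2 /\
    {in l1 & l2, forall i j : 'I_n, i < j}.
  move: sl; rewrite -(cat_take_drop (size s1) l) sorted_pairwise // pairwise_cat.
  move=> /and3P[/allrelP h _ h2]; split => //.
  by rewrite sorted_pairwise.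
have [CC [cCC hCC sCC]] : exists CC : {set {set 'I_n}}, [/\ #|CC| = p,
        {in CC, forall C : {set 'I_n}, [/\ #|C| = 2 ^ k, {subset C <= l2} &
          simple_mx (submatrix M Q C)]} &
        {in CC &, forall C C' : {set 'I_n}, C <> C' -> separated C C'}].
  by apply: ih => //; rewrite e2.
(* For [A] not inside [Q] any column will do; it only makes the choice function total. *)
have ex (A : {set 'I_m}) : exists j : 'I_n,
    A \subset Q -> j \in l1 /\ column_set j :&: Q = A.
  have [AQ|nAQ] := boolP (A \subset Q).
    have [B + BQ] := sh A AQ; rewrite -e1 => /mapP[j jl1 eB].
    by exists j => _; rewrite -eB.
  have [B + _] := sh Q (subxx Q); rewrite -e1 => /mapP[j _ _].
  by exists j.
have [f hf] := choice ex.
pose C0 := f @: powerset Q.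
have finj : {in powerset Q &, injective f}.
  move=> A B; rewrite !powersetE => /hf[_ hA] /hf[_ hB] eAB.
  by rewrite -hA -hB eAB.
have cC0 : #|C0| = 2 ^ k by rewrite card_in_imset // card_powerset Qk.
have C0l1 : {subset C0 <= l1}.
  by move=> j /imsetP[A]; rewrite powersetE => /hf[h _] ->.
have sC0 : simple_mx (submatrix M Q C0).
  apply: simple_submatrix => i j /imsetP[A + ->] /imsetP[B + ->].
  by rewrite !powersetE => /hf[_ ->] /hf[_ ->] ->.
have nonempty (C : {set 'I_n}) : #|C| = 2 ^ k -> C != finset.set0.
  by move=> hC; rewrite -card_gt0 hC expn_gt0.
have sep C : C \in CC -> max_idx C0 < min_idx C.
  move=> /hCC[cC Cl2 _]; apply: max_idx_lt_min_idx; try exact: nonempty.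
  by move=> i j /C0l1 il /Cl2 jl; exact: lt12.
have C0CC : C0 \notin CC.
  apply/negP => h; have [_ h2 _] := hCC _ h.
  have /set0Pn[i iC0] := nonempty _ cC0.
  by have := lt12 i i (C0l1 _ iC0) (h2 _ iC0); rewrite ltnn.
exists (C0 |: CC); split.
- by rewrite cardsU1 C0CC cCC.
- move=> C /setU1P[->|/hCC[hc hl hs]]; split => //.
    by move=> j /C0l1 /mem_take.
  by move=> j /hl /mem_drop.
- move=> C C' /setU1P[->|hC] /setU1P[->|hC'] ne //.
  + by left; exact: sep.
  + by right; exact: sep.
  + exact: sCC.
Qed.

(** Families for different row sets never compete, so those of all [k]-sets [Q] are combined as
    pairs and their sizes add up. *)
Lemma total_count_contributions k :
  exists S, contributions k M S /\
    #|S| = total_count k [set: 'I_m] [seq column_set j | j <- enum 'I_n].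
Proof.
set s := [seq column_set j | j <- enum 'I_n].
have srt : sorted (fun i j : 'I_n => i < j) (enum 'I_n).
  by have := iota_ltn_sorted 0 n; rewrite -val_enum_ord sorted_map.
have ex (Q : {set 'I_m}) : exists CC : {set {set 'I_n}}, #|Q| = k ->
    [/\ #|CC| = segment_count Q s,
        {in CC, forall C : {set 'I_n}, [/\ #|C| = 2 ^ k, {subset C <= enum 'I_n} &
          simple_mx (submatrix M Q C)]} &
        {in CC &, forall C C' : {set 'I_n}, C <> C' -> separated C C'}].
  have [/eqP Qk|Qk] := boolP (#|Q| == k); last first.
    by exists finset.set0 => /eqP; rewrite (negbTE Qk).
  have [CC h] := segments_contributions Qk srt (segment_countP Q s).
  by exists CC.
have [CC hCC] := choice ex.
exists [set q : {set 'I_m} * {set 'I_n} | (#|q.1| == k) && (q.2 \in CC q.1)].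
split; first split.
- move=> [Q C]; rewrite inE /= => /andP[/eqP Qk CQ].
  by have [_ /(_ _ CQ)[]] := hCC Q Qk.
- move=> [Q C] [Q' C']; rewrite !inE /= => /andP[/eqP Qk CQ] /andP[_ CQ'] ne e.
  move: CQ' ne; rewrite -e => CQ' ne.
  have [_ _] := hCC Q Qk; apply => // eC; apply: ne; by rewrite eC.
- rewrite /total_count -sum1_card.
  rewrite (eq_bigl (fun q : {set 'I_m} * {set 'I_n} =>
    (#|q.1| == k) && (q.2 \in CC q.1))); last by move=> q; rewrite inE.
  rewrite -(pair_big_dep (fun Q : {set 'I_m} => #|Q| == k)
    (fun Q C => C \in CC Q) (fun _ _ => 1)) /=.
  rewrite (eq_bigl (fun Q : {set 'I_m} => (Q \subset [set: 'I_m]) && (#|Q| == k))); last first.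
    by move=> Q; rewrite finset.subsetT.
  apply: eq_bigr => Q /andP[_ /eqP Qk]; rewrite sum1_card.
  by have [] := hCC Q Qk.
Qed.

End Matrices.

Theorem theorem4p3 (R : realType) (k : nat) (hk : (3 <= k)%N) :
  let alpha : R := 2 * k%:R / 3 - 1 in
  forall eps : R, 0 < eps ->
  exists c : R, 0 < c /\
    forall m : nat, (k <= m)%N ->
    forall M : 'M[bool]_(m, Num.truncn (c * m%:R ^+ (k - 1))),
      simple_mx M ->
      makes_contributions k M (m%:R `^ (k%:R - 1 - alpha - eps)).
Proof.
move=> alpha eps eps0.
have [c hc] := guarantees_third hk eps0.
(* The successor ensures positivity, and an integral constant makes the truncated number of columns
   exact. *)
exists c.+1%:R; split=> [|m km M hM]; first by rewrite ltr0n.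
have [S [hS cS]] := total_count_contributions M k.
exists S; split => //; rewrite cS.
have -> : k%:R - 1 - alpha - eps = k%:R / 3 - eps by rewrite /alpha; field.
have cT : #|[set: 'I_m]| = m by rewrite cardsT card_ord.
have := hc 'I_m [set: 'I_m] [seq column_set M j | j <- enum 'I__].
rewrite cT mul1r; apply => //.
- by rewrite map_inj_uniq ?enum_uniq //; exact: column_set_inj.
- rewrite size_map size_enum_ord -natrX -natrM natrK subn1.
  by rewrite leq_mul2r leqnSn orbT.
Qed.
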